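(* Let $X$ be a topological Hausdorff space. The topology induced on $X$ by the canonical uniform structure $CU(X)$ coincides with the original topology of $X$ if and only if $X$ is completely regular.
   Context: Entourages of uniform structures are taken to be symmetric subsets of $X\times X$. The canonical uniform structure $CU(X)$ on a topological space $X$ is defined as follows: a symmetric set $E\subset X\times X$ is an entourage iff there is a partition of unity $f=\{f_s\}_{s\in S}$ on $X$ (a family of continuous functions $f_s\colon X\to[0,1]$ with $\sum_{s\in S}f_s(x)=1$ for all $x\in X$) such that $E$ contains $E_f:=\{(x,y)\in X\times X : \text{there is } s\in S\text{ with } f_s(x)\cdot f_s(y)>0\}$. The topology induced by a uniform structure: $U\subset X$ is open iff for each $x\in U$ there is an entourage $E_x$ with $B(x,E_x)\subset U$, where $B(x,E)=\{y\in X : (x,y)\in E\}$. *)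

(* Defs.v *)
From mathcomp Require Import all_boot all_order all_algebra.
From mathcomp Require Import all_classical all_reals all_analysis.
Set Implicit Arguments.
Unset Strict Implicit.
Unset Printing Implicit Defensive.
Import Order.TTheory GRing.Theory Num.Theory.
Import numFieldNormedType.Exports.
Local Open Scope classical_set_scope.
Local Open Scope ring_scope.

(* No local finiteness is required: the possibly infinite sum of nonnegative
   terms is the supremum of its finite partial sums. Requiring the index type
   to be a choiceType is no restriction, see [{classic S}] in boolp. *)
Definition partition_of_unity (R : realType) (X : topologicalType)
    (S : choiceType) (f : S -> X -> R) : Prop :=
  [/\ forall s, continuous (f s),
      forall s x, 0 <= f s x <= 1 &
      forall x, (\esum_(s in [set: S]) (f s x)%:E = 1)%E].

Definition pou_entourage (R : realType) (X : topologicalType)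
    (S : choiceType) (f : S -> X -> R) : set (X * X) :=
  [set xy | exists s, 0 < f s xy.1 * f s xy.2].

(* The set of entourages of CU(X). Entourages are symmetric here, unlike those
   of [uniformType], which are closed under arbitrary supersets. *)
Definition canonical_uniformity (R : realType) (X : topologicalType) :
    set_system (X * X) :=
  [set E | (E^-1)%relation = E /\
           exists (S : choiceType) (f : S -> X -> R),
             partition_of_unity f /\ pou_entourage f `<=` E].
Arguments canonical_uniformity : clear implicits.

(* [xsection E x] is the ball B(x, E). *)
Definition uniform_open (X : Type) (ent : set_system (X * X)) (U : set X) :
    Prop :=
  forall x, U x -> exists2 E, ent E & xsection E x `<=` U.

(* The T1 axiom is not part of this notion. The usual definition by real-valued
   functions is used because [completely_regular_space] is phrased in terms of
   uniform structures; [completely_regularP] shows that they agree. *)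
Definition completely_regular (R : realType) (X : topologicalType) : Prop :=
  forall (a : X) (B : set X), closed B -> ~ B a ->
  exists f : X -> R,
    [/\ continuous f, forall x, 0 <= f x <= 1, f a = 0 &
        forall x, B x -> f x = 1].

Lemma completely_regularP (R : realType) (X : topologicalType) :
  completely_regular R X <-> completely_regular_space X.
Proof.
split=> crX a B clB nBa; have := crX a B clB nBa.
- case=> f [cf f01 fa fB]; apply/(@uniform_separatorP _ R).
  exists f; split=> //.
  + by move=> _ [x _ <-]; rewrite /= in_itv /=; exact: f01.
  + by move=> _ [x -> <-].
  + by move=> _ [x Bx <-]; exact: fB.
- move/(@uniform_separatorP _ R) => [f [cf f01 fa fB]].
  exists f; split=> //.
  + by move=> x; have := f01 (f x) (ex_intro2 _ _ x I erefl); rewrite /= in_itv.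
  + by apply: fa; exists a.
  + by move=> x Bx; apply: fB; exists x.
Qed.

(* Main.v *)
Require Import Defs.
From mathcomp Require Import all_boot all_order all_algebra.
From mathcomp Require Import all_classical all_reals all_analysis.
From mathcomp Require Import lra.
Set Implicit Arguments.
Unset Strict Implicit.
Unset Printing Implicit Defensive.
Import Order.TTheory GRing.Theory Num.Theory.
Import numFieldNormedType.Exports.
Local Open Scope classical_set_scope.
Local Open Scope ring_scope.

(** Members of partitions of unity are the only link needed between balls and
    continuous functions.  If [f] is a partition of unity and [f s a > 0], then
    the ball of [a] for [pou_entourage f] contains the cozero set
    [{y | 0 < f s y}], since [f s a * f s y > 0] there.  Such an [s] always
    exists, because the values at [a] sum to [1].  Two consequences follow.

    On the one hand, every such ball contains an open neighbourhood of its
    center, so a uniformly open set is open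
    ([uniform_open_canonical_open]).  On the other hand, if [U] is uniformly
    open and contains [a], then some [f s] is positive at [a] and zero off [U]
    ([uniform_open_separates]); rescaling and truncating it gives the function
    [max 0 (1 - f s / f s a)], which is [0] at [a] and [1] off [U].  So if every
    open set is uniformly open, the space is completely regular.

    Conversely, let [g] be continuous with values in [0, 1], [0] at [x] and [1]
    off an open set [U].  The pair [1 - g, g] is a partition of unity
    ([partition_of_unity_onem]).  Only [1 - g] is nonzero at [x], so the ball of
    [x] is the cozero set of [1 - g], which lies in [U]
    ([completely_regular_open_uniform_open]). *)

Lemma partition_of_unity_gt0 (R : realType) (X : topologicalType)
    (S : choiceType) (f : S -> X -> R) (x : X) :
  partition_of_unity f -> exists s, 0 < f s x.
Proof.
move=> [_ f01 /(_ x) f1]; apply: contrapT => /forallNP f0.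
have : (\esum_(s in [set: S]) (f s x)%:E = 0)%E.
  apply: esum1 => s _; congr _%:E; apply/eqP; rewrite eq_le.
  by rewrite leNgt; case/andP: (f01 s x) => -> _; rewrite andbT; exact/negP.
by rewrite f1 => -[] /eqP; rewrite oner_eq0.
Qed.

Lemma partition_of_unity_onem (R : realType) (X : topologicalType)
    (g : X -> R) :
  continuous g -> (forall x, 0 <= g x <= 1) ->
  partition_of_unity (fun (b : bool) x => if b then 1 - g x else g x).
Proof.
move=> cg g01; split.
- case=> // x; apply: cvgB; [exact: cvg_cst | exact: cg].
- by move=> [] x //; have := g01 x; lra.
- move=> x.
  have f0 b : (0 <= (if b then 1 - g x else g x)%:E)%E.
    by rewrite lee_fin; case: b; have := g01 x; lra.
  rewrite (esumID [set true]) // setTI.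
  have -> : [set: bool] `&` ~` [set true] = [set false].
    by apply/seteqP; split=> [] [] //= [].
  rewrite !esum_set1 /= -?EFinD ?subrK //.
    exact: (f0 false).
  exact: (f0 true).
Qed.

Lemma pou_entourage_canonical (R : realType) (X : topologicalType)
    (S : choiceType) (f : S -> X -> R) :
  partition_of_unity f -> canonical_uniformity R X (pou_entourage f).
Proof.
move=> pf; split; last by exists S, f; split=> // xy.
by apply/seteqP; split=> -[x y] [s /= fs]; exists s; rewrite /= mulrC.
Qed.

(** Each ball contains the cozero set of a member that is positive at its
    center, and cozero sets of continuous functions are open: the topology of
    CU(X) is coarser than the original one. *)
Lemma uniform_open_canonical_open (R : realType) (X : topologicalType)
    (U : set X) :
  uniform_open (canonical_uniformity R X) U -> open U.
Proof.
move=> oU; rewrite openE => x Ux.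
have [E [_ [S [f [pf fE]]]] EU] := oU x Ux.
have [s fsx] := partition_of_unity_gt0 x pf.
have [/(_ s x) cfs _ _] := pf.
have : \forall y \near x, 0 < f s y by apply: (cvgr_gt (f s x)).
apply: filterS => y fsy; apply: EU; rewrite /xsection /= inE; apply: fE.
by exists s; rewrite /= mulr_gt0.
Qed.

(** Two functions suffice: with [g x = 0], only the member [1 - g] sees [x], and
    it vanishes wherever [g] is [1]. *)
Lemma completely_regular_open_uniform_open (R : realType)
    (X : topologicalType) (U : set X) :
  completely_regular R X -> open U -> uniform_open (canonical_uniformity R X) U.
Proof.
move=> crX oU x Ux.
have [g [cg g01 gx gU]] := crX x (~` U) (open_closedC oU) (fun nUx => nUx Ux).
exists (pou_entourage (fun (b : bool) x => if b then 1 - g x else g x)).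
  exact/pou_entourage_canonical/partition_of_unity_onem.
(* The index [false] is impossible: its function [g] is zero at [x]. *)
move=> y; rewrite /xsection /= inE => -[[] /=]; rewrite gx ?mul0r ?ltxx //.
by move=> gy; apply: contrapT => /gU gy1; move: gy; rewrite gy1 subrr mulr0 ltxx.
Qed.

(** The function is the member of the partition that is positive at [a]: a
    point where it is positive as well lies in the ball of [a], hence in [U]. *)
Lemma uniform_open_separates (R : realType) (X : topologicalType)
    (U : set X) (a : X) :
  uniform_open (canonical_uniformity R X) U -> U a ->
  exists h : X -> R, [/\ continuous h, forall x, 0 <= h x, 0 < h a &
    forall x, ~ U x -> h x = 0].
Proof.
move=> oU Ua; have [E [_ [S [f [pf fE]]]] EU] := oU a Ua.
have [s fsa] := partition_of_unity_gt0 a pf.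
have [cf f01 _] := pf.
have f0 x : 0 <= f s x by case/andP: (f01 s x).
exists (f s); split=> // x nUx; apply/eqP; rewrite eq_le f0 andbT leNgt.
apply/negP => fsx; apply: nUx; apply: EU; rewrite /xsection /= inE; apply: fE.
by exists s; rewrite /= mulr_gt0.
Qed.

Lemma open_uniform_open_completely_regular (R : realType)
    (X : topologicalType) :
  (forall U : set X, open U -> uniform_open (canonical_uniformity R X) U) ->
  completely_regular R X.
Proof.
move=> oX a B clB nBa.
have [h [ch h0 ha hB]] := uniform_open_separates (oX _ (closed_openC clB)) nBa.
(* Dividing by [h a] gives the value [0] at [a]; the truncation is for the
   points where [h] exceeds [h a]. *)
exists (fun x => Num.max 0 (1 - h x / h a)); split.
- apply: (@max_fun_continuous _ _ R (cst 0) (fun x => 1 - h x / h a)) => x.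
    exact: cvg_cst.
  by apply: cvgB; [exact: cvg_cst | apply: cvgM; [exact: ch | exact: cvg_cst]].
- move=> x; rewrite le_max lexx /= ge_max ler01 /= gerBl.
  by rewrite divr_ge0 // ltW.
- by rewrite divff ?gt_eqF // subrr maxxx.
- by move=> x Bx; rewrite hB // mul0r subr0 max_r.
Qed.

Theorem proposition2p6 (R : realType) (X : topologicalType)
    (hX : hausdorff_space X) :
  (forall U : set X, uniform_open (canonical_uniformity R X) U <-> open U) <->
  completely_regular R X.
Proof.
split=> [uoX | crX U].
- by apply: open_uniform_open_completely_regular => U /uoX.
- split; first exact: uniform_open_canonical_open.
  exact: completely_regular_open_uniform_open.
Qed.
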